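(* Let $\mathcal{X}$ be a set equipped with a binary relation $\preceq$, let $m \ge 2$, $x_1,\ldots,x_m \in \mathcal{X}$, and let $w_1,\ldots,w_m > 0$. For $\boldsymbol{z} \in \mathbb{R}^m$ let $A(\boldsymbol{z})$ denote the weighted least squares antitonic approximation of $\boldsymbol{z}$, i.e. the unique minimizer of $\sum_{j=1}^m w_j (z_j - f_j)^2$ over all $\boldsymbol{f} \in \mathbb{R}^m$ such that $x_i \preceq x_j$ implies $f_i \ge f_j$. Let $\boldsymbol{z}, \tilde{\boldsymbol{z}} \in \mathbb{R}^m$ be such that $\tilde{\boldsymbol{z}} \ge \boldsymbol{z}$ component-wise, and set $\boldsymbol{f} := A(\boldsymbol{z})$, $\tilde{\boldsymbol{f}} := A(\tilde{\boldsymbol{z}})$ and $K := \{k \in \{1,\ldots,m\} : \tilde{z}_k > z_k\}$. Then the following hold: (i) $\boldsymbol{f} \le \tilde{\boldsymbol{f}}$ component-wise. (ii) For every $i \in \{1,\ldots,m\}$: $\tilde{f}_i = f_i$ whenever $f_i < \min_{k \in K} f_k$. (iii) For every $i \in \{1,\ldots,m\}$: $\tilde{f}_i = f_i$ whenever $\tilde{f}_i > \max_{k \in K} \tilde{f}_k$. (iv) For all $i, j \in \{1,\ldots,m\}$: $\tilde{f}_i = \tilde{f}_j$ whenever $f_i = f_j$ and both $x_i \preceq x_k$ and $x_j \preceq x_k$ for all $k \in K$.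
   Context: The relation $\preceq$ is an arbitrary binary relation on $\mathcal{X}$; it is not assumed to be reflexive, transitive or antisymmetric. The feasible set is $$\mathbb{R}^m_{\downarrow,\boldsymbol{x}} := \{\boldsymbol{f} \in \mathbb{R}^m : x_i \preceq x_j \text{ implies } f_i \ge f_j\},$$ which is a non-empty closed convex set. Since the weighted sum of squares is strictly convex and coercive in $\boldsymbol{f}$, the minimizer $A(\boldsymbol{z}) = \operatorname{arg\,min}_{\boldsymbol{f} \in \mathbb{R}^m_{\downarrow,\boldsymbol{x}}} \sum_{j=1}^m w_j (z_j - f_j)^2$ exists and is unique. If $K = \emptyset$, use the conventions $\min_{k\in\emptyset} = +\infty$ and $\max_{k\in\emptyset} = -\infty$. *)

(* Defs.v *)
From mathcomp Require Export all_boot all_order all_algebra.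
From mathcomp Require Export all_classical all_reals all_analysis.
From mathcomp Require Import ring lra.

Set Implicit Arguments.
Unset Strict Implicit.
Unset Printing Implicit Defensive.

Import Order.TTheory GRing.Theory Num.Theory.
Import numFieldNormedType.Exports.

Local Open Scope classical_set_scope.
Local Open Scope ring_scope.

(* The relation [prec] is arbitrary (no order axiom is assumed). *)
Definition antitonic_set (R : realType) (X : Type) (prec : X -> X -> Prop)
    (m : nat) (x : 'I_m -> X) : set 'rV[R]_m :=
  [set f | forall i j, prec (x i) (x j) -> f 0 j <= f 0 i].

Definition wssq (R : realType) (m : nat) (w z f : 'rV[R]_m) : R :=
  \sum_(j < m) w 0 j * (z 0 j - f 0 j) ^+ 2.

Definition argmin (R : realType) (T : Type) (S : set T) (phi : T -> R) :
    set T :=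
  [set f | S f /\ forall g, S g -> phi f <= phi g].

(* The default value 0 of [xget] is never used for positive weights: see
   [antitonic_approxP] and [antitonic_approx_unique]. *)
Definition antitonic_approx (R : realType) (X : Type) (prec : X -> X -> Prop)
    (m : nat) (x : 'I_m -> X) (w z : 'rV[R]_m) : 'rV[R]_m :=
  xget 0 (argmin (antitonic_set prec x) (wssq w z)).

Lemma wssq_continuous (R : realType) (m : nat) (w z : 'rV[R]_m) :
  continuous (wssq w z).
Proof.
apply: (@continuous_big R 'I_m +%R 0 xpredT _ 'rV[R]_m (index_enum 'I_m)
  (fun j g => w 0 j * (z 0 j - g 0 j) ^+ 2)) => [|j _ f].
  exact: add_continuous.
have h : (z 0 j - g 0 j) @[g --> f] --> z 0 j - f 0 j.
  by apply: cvgB; [exact: cvg_cst | exact: (@coord_continuous R 1 m)].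
by have := cvgM (cvg_cst (w 0 j)) (cvgM h h); apply.
Qed.

Lemma antitonic_set_closed (R : realType) (X : Type) (prec : X -> X -> Prop)
    (m : nat) (x : 'I_m -> X) : closed (@antitonic_set R X prec m x).
Proof.
have -> : @antitonic_set R X prec m x =
  \bigcap_(p in [set p : 'I_m * 'I_m | prec (x p.1) (x p.2)])
    [set f : 'rV[R]_m | 0 <= f 0 p.1 - f 0 p.2].
  apply/seteqP; split => [f hf [i j] /= hij|f hf i j hij] /=.
    by rewrite subr_ge0; exact: hf.
  by have := hf (i, j) hij; rewrite /= subr_ge0.
apply: closed_bigI => -[i j] _ /=.
apply: (@preimage_closed _ _ (fun f : 'rV[R]_m => f 0 i - f 0 j)
  [set y | 0 <= y]); last exact: closed_ge.
move=> f _.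
have h k : (g 0 k) @[g --> f] --> f 0 k by exact: (@coord_continuous R 1 m).
exact: (cvgB (h i) (h j)).
Qed.

Lemma antitonic_approxP (R : realType) (X : Type) (prec : X -> X -> Prop)
    (m : nat) (x : 'I_m -> X) (w z : 'rV[R]_m) :
  (forall j, 0 < w 0 j) ->
  argmin (antitonic_set prec x) (wssq w z) (antitonic_approx prec x w z).
Proof.
move=> w0; apply: xgetPex.
set S := antitonic_set prec x; set phi := wssq w z.
have S0 : S 0 by move=> i j _; rewrite !mxE.
pose c j : R := 1 + phi 0 / w 0 j.
pose B : set 'rV[R]_m :=
  [set f | forall j, f 0 j \in `[z 0 j - c j, z 0 j + c j]].
have Bphi f : phi f <= phi 0 -> B f.
  move=> hf j; have : w 0 j * (z 0 j - f 0 j) ^+ 2 <= phi 0.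
    apply: le_trans hf; rewrite /phi /wssq (bigD1 j) //= lerDl.
    by apply: sumr_ge0 => k _; rewrite mulr_ge0 ?sqr_ge0// ltW.
  rewrite mulrC -ler_pdivlMr// in_itv/= /c => h.
  have := sqr_ge0 (z 0 j - f 0 j - 1); have := sqr_ge0 (z 0 j - f 0 j + 1).
  by move: h; rewrite !expr2 => ? ? ?; apply/andP; split; lra.
have cB : compact B.
  rewrite (_ : B = [set f : 'rV[R]_m | forall j,
      `[z 0 j - c j, z 0 j + c j]%classic (f ord0 j)]).
    by apply: (@rV_compact R m (fun j => `[z 0 j - c j, z 0 j + c j]%classic))
      => j; exact: segment_compact.
  by apply/seteqP; split => f hf j; exact: hf.
have [f [/set_mem[Bf Sf] fmin]] : exists2 f, f \in B `&` S &
    forall g, g \in B `&` S -> phi f <= phi g.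
  apply: EVT_min_rV.
  - by exists 0; split=> //; exact: Bphi.
  - by apply: compact_closedI => //; exact: antitonic_set_closed.
  - by apply: continuous_subspaceT; exact: wssq_continuous.
exists f; split => // g Sg.
have [gle|/ltW gge] := leP (phi g) (phi 0).
  by apply: fmin; apply/mem_set; split => //; exact: Bphi.
apply: le_trans gge; apply: fmin; apply/mem_set; split => //; exact: Bphi.
Qed.

Lemma antitonic_approx_unique (R : realType) (X : Type)
    (prec : X -> X -> Prop) (m : nat) (x : 'I_m -> X) (w z f : 'rV[R]_m) :
  (forall j, 0 < w 0 j) ->
  argmin (antitonic_set prec x) (wssq w z) f ->
  f = antitonic_approx prec x w z.
Proof.
move=> w0 [Sf fmin].
have [] := antitonic_approxP prec x z w0.
set g := antitonic_approx prec x w z => Sg gmin.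
pose h : 'rV[R]_m := \row_j ((f 0 j + g 0 j) / 2).
have Sh : antitonic_set prec x h.
  move=> i j hij; rewrite !mxE.
  by have := Sf i j hij; have := Sg i j hij; lra.
have := fmin _ Sh; have := gmin _ Sh => gh fh.
have par : wssq w z f + wssq w z g - wssq w z h *+ 2 =
    \sum_j w 0 j * (f 0 j - g 0 j) ^+ 2 / 2.
  rewrite /wssq -sumrMnl -big_split -sumrB /=.
  by apply: eq_bigr => j _; rewrite !mxE; field.
have le0 : \sum_j w 0 j * (f 0 j - g 0 j) ^+ 2 / 2 <= 0.
  by rewrite -par; lra.
have ge0 (j : 'I_m) : true -> 0 <= w 0 j * (f 0 j - g 0 j) ^+ 2 / 2.
  by move=> _; rewrite divr_ge0// mulr_ge0 ?sqr_ge0// ltW.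
have eq0 : \sum_j w 0 j * (f 0 j - g 0 j) ^+ 2 / 2 = 0.
  by apply/eqP; rewrite eq_le le0 sumr_ge0.
apply/rowP => j; move/psumr_eq0P: eq0 => /(_ ge0 j isT)/eqP.
by rewrite !mulf_eq0 invr_eq0 pnatr_eq0 (gt_eqF (w0 j)) orbF/= orbb subr_eq0
  => /eqP.
Qed.

(* Main.v *)
(** If moving part of the excess of one fit to the other turns the pair
    (f, ft) into a feasible pair (g, h) without increasing any of the terms
    (z_j - f_j)^2 + (zt_j - ft_j)^2, then g and h are minimizers as well, hence
    (g, h) = (f, ft) by uniqueness. Part (i) exchanges the componentwise minimum
    and maximum of f and ft. Parts (ii) and (iii) use the pairs (f + d, ft - d)
    with 0 <= d <= ft - f supported where z = zt: truncating at a level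
    c <= min_K f, respectively c >= max_K ft, yields such a d that keeps both
    vectors feasible. Part (iv) follows from (i) and (iii). *)
Require Import Defs.
From mathcomp Require Import lra.
Import Order.TTheory GRing.Theory Num.Theory.
Local Open Scope ring_scope.

Section AntitonicApproximation.
Variables (R : realType) (X : Type) (prec : X -> X -> Prop).
Variables (m : nat) (x : 'I_m -> X) (w : 'rV[R]_m).
Hypothesis w_gt0 : forall j, 0 < w 0 j.

Local Notation S := (antitonic_set prec x).
Local Notation A := (antitonic_approx prec x w).

Lemma antitonic_approx_in (z : 'rV[R]_m) : S (A z).
Proof. by case: (antitonic_approxP prec x z w_gt0). Qed.

Lemma antitonic_approx_eq (z g : 'rV[R]_m) :
  S g -> wssq w z g <= wssq w z (A z) -> g = A z.
Proof.
move=> Sg gle; apply: antitonic_approx_unique => //; split=> // h Sh.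
by apply: le_trans gle _; case: (antitonic_approxP prec x z w_gt0) => _; apply.
Qed.

(** Neither objective can fall below its minimum, so a bound on their sum by the sum of the minima
    forces equality in both. *)
Lemma antitonic_approx_exchange (z zt g h : 'rV[R]_m) :
  S g -> S h ->
  (forall j, (z 0 j - g 0 j) ^+ 2 + (zt 0 j - h 0 j) ^+ 2 <=
             (z 0 j - A z 0 j) ^+ 2 + (zt 0 j - A zt 0 j) ^+ 2) ->
  g = A z /\ h = A zt.
Proof.
move=> Sg Sh le_gh.
have le_sum : wssq w z g + wssq w zt h <= wssq w z (A z) + wssq w zt (A zt).
  rewrite /wssq -!big_split /=; apply: ler_sum => j _.
  by rewrite -!mulrDr ler_wpM2l ?le_gh// ltW.
have [_ /(_ _ Sg) minz] := antitonic_approxP prec x z w_gt0.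
have [_ /(_ _ Sh) minzt] := antitonic_approxP prec x zt w_gt0.
by split; apply: antitonic_approx_eq => //; lra.
Qed.

Variables z zt : 'rV[R]_m.
Hypothesis le_z : forall j, z 0 j <= zt 0 j.

Local Notation f j := (A z 0 j).
Local Notation ft j := (A zt 0 j).

Lemma antitonic_approx_le i : f i <= ft i.
Proof.
have Sf := antitonic_approx_in z; have Sft := antitonic_approx_in zt.
pose g : 'rV[R]_m := \row_j Num.min (f j) (ft j).
pose h : 'rV[R]_m := \row_j Num.max (f j) (ft j).
have Sg : S g.
  by move=> a b ab; rewrite !mxE le_min !ge_min Sf// Sft// orbT.
have Sh : S h.
  by move=> a b ab; rewrite !mxE ge_max !le_max Sf// Sft// orbT.
have [|/rowP/(_ i) + _] := antitonic_approx_exchange z zt g h Sg Sh.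
  move=> j; rewrite !mxE; have := le_z j.
  (* If [ft j < f j], the swap changes the sum by [2 * (zt j - z j) * (ft j - f j) <= 0]. *)
  by case: (leP (f j) (ft j)) => //; nra.
by rewrite mxE => <-; rewrite ge_min lexx orbT.
Qed.

Lemma antitonic_approx_shift (d : 'I_m -> R) :
  (forall j, 0 <= d j <= ft j - f j) ->
  (forall j, z 0 j < zt 0 j -> d j = 0) ->
  S (\row_j (f j + d j)) -> S (\row_j (ft j - d j)) ->
  forall j, d j = 0.
Proof.
move=> d_bnd d_supp Sg Sh j.
have [|/rowP/(_ j) + _] := antitonic_approx_exchange z zt _ _ Sg Sh; last first.
  by rewrite mxE; lra.
move=> k; rewrite !mxE; have /andP[d0 dle] := d_bnd k.
have [/d_supp ->|zge] := ltP (z 0 k) (zt 0 k); first by rewrite addr0 subr0.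
have -> : zt 0 k = z 0 k by apply/eqP; rewrite eq_le zge le_z.
(* With equal data the change is [- 2 * d k * (ft k - f k - d k)]. *)
nra.
Qed.

Lemma antitonic_approx_eq_below i :
  (forall k, z 0 k < zt 0 k -> f i < f k) -> ft i = f i.
Proof.
have Sf := antitonic_approx_in z; have Sft := antitonic_approx_in zt.
(* The default [f i + 1] keeps [f i < c] even when no [k] has [z k < zt k]. *)
move=> lt_i; pose c := \big[Num.min/f i + 1]_(k | z 0 k < zt 0 k) f k.
have lt_c : f i < c by apply: lt_bigmin => //; rewrite ltrDl.
have c_le k : z 0 k < zt 0 k -> c <= f k by move=> ?; exact: bigmin_le_cond.
(* As [f j <= ft j], this is the length of the part of [[f j, ft j]] below [c]. Both
   [f + d = max(f, min(ft, c))] and [ft - d = min(f, c) + max(ft, c) - c] are nondecreasing in [f]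
   and [ft], hence antitonic. *)
pose d j := Num.max (f j) (Num.min (ft j) c) - f j.
have dP j : [\/ c <= f j /\ d j = 0, ft j <= c /\ d j = ft j - f j
               | f j <= c <= ft j /\ d j = c - f j].
  rewrite /d; have := antitonic_approx_le j.
  have [ft_c|c_ft] := leP (ft j) c => f_ft.
    by apply: Or32; rewrite max_r.
  have [f_c|c_f] := leP (f j) c; last by apply: Or31; rewrite subrr ltW.
  by apply: Or33; rewrite ltW.
have : d i = 0.
  apply: antitonic_approx_shift => [j|j|a b ab|a b ab].
  - by have := antitonic_approx_le j; have [[]|[]|[/andP[]]] := dP j; lra.
  - by move: (antitonic_approx_le j) => + /c_le; have [[]|[]|[/andP[]]] := dP j; lra.
  - have := antitonic_approx_le a; have := antitonic_approx_le b.
    have := Sf _ _ ab; have := Sft _ _ ab; rewrite !mxE.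
    by have [[]|[]|[/andP[]]] := dP a; have [[]|[]|[/andP[]]] := dP b; lra.
  - have := antitonic_approx_le a; have := antitonic_approx_le b.
    have := Sf _ _ ab; have := Sft _ _ ab; rewrite !mxE.
    by have [[]|[]|[/andP[]]] := dP a; have [[]|[]|[/andP[]]] := dP b; lra.
(* Since [f i < c], a zero length below [c] leaves only [ft i = f i]. *)
by have := antitonic_approx_le i; have [[]|[]|[/andP[]]] := dP i; lra.
Qed.

Lemma antitonic_approx_eq_above i :
  (forall k, z 0 k < zt 0 k -> ft k < ft i) -> ft i = f i.
Proof.
have Sf := antitonic_approx_in z; have Sft := antitonic_approx_in zt.
move=> lt_i; pose c := \big[Num.max/ft i - 1]_(k | z 0 k < zt 0 k) ft k.
have lt_c : c < ft i by apply: bigmax_lt => //; rewrite ltrBlDr ltrDl.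
have c_ge k : z 0 k < zt 0 k -> ft k <= c by move=> ?; exact: le_bigmax_cond.
(* Now the length of the part above [c]: [f + d = min(f, c) + max(ft, c) - c] and
   [ft - d = min(max(f, c), ft)]. *)
pose d j := ft j - Num.min (Num.max (f j) c) (ft j).
have dP j : [\/ ft j <= c /\ d j = 0, c <= f j /\ d j = ft j - f j
               | f j <= c <= ft j /\ d j = ft j - c].
  rewrite /d; have := antitonic_approx_le j.
  have [f_c|c_f] := leP (f j) c => f_ft; last first.
    by apply: Or32; rewrite min_l // ltW.
  have [c_ft|ft_c] := leP c (ft j); first exact: Or33.
  by apply: Or31; rewrite subrr ltW.
have : d i = 0.
  apply: antitonic_approx_shift => [j|j|a b ab|a b ab].
  - by have := antitonic_approx_le j; have [[]|[]|[/andP[]]] := dP j; lra.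
  - by move: (antitonic_approx_le j) => + /c_ge; have [[]|[]|[/andP[]]] := dP j; lra.
  - have := antitonic_approx_le a; have := antitonic_approx_le b.
    have := Sf _ _ ab; have := Sft _ _ ab; rewrite !mxE.
    by have [[]|[]|[/andP[]]] := dP a; have [[]|[]|[/andP[]]] := dP b; lra.
  - have := antitonic_approx_le a; have := antitonic_approx_le b.
    have := Sf _ _ ab; have := Sft _ _ ab; rewrite !mxE.
    by have [[]|[]|[/andP[]]] := dP a; have [[]|[]|[/andP[]]] := dP b; lra.
by have := antitonic_approx_le i; have [[]|[]|[/andP[]]] := dP i; lra.
Qed.

(** If [ft i < ft j], antitonicity puts every [ft k] with [z k < zt k] at or below [ft i], hence
    below [ft j]. Then [ft j = f j = f i <= ft i], a contradiction. *)
Lemma antitonic_approx_tie_le i j :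
  f i = f j -> (forall k, z 0 k < zt 0 k -> prec (x i) (x k)) ->
  ft j <= ft i.
Proof.
move=> eq_ij prec_i; rewrite leNgt; apply/negP => lt_ij.
have eq_j : ft j = f j.
  apply: antitonic_approx_eq_above => k /prec_i ik.
  exact: le_lt_trans (antitonic_approx_in zt _ _ ik) lt_ij.
by have := antitonic_approx_le i; lra.
Qed.

End AntitonicApproximation.

Theorem lemma2p1 (R : realType) (X : Type) (prec : X -> X -> Prop)
    (m : nat) (hm : (2 <= m)%N) (x : 'I_m -> X)
    (w : 'rV[R]_m) (hw : forall j, 0 < w 0 j)
    (z zt : 'rV[R]_m) (hz : forall k, z 0 k <= zt 0 k) :
  let f := antitonic_approx prec x w z in
  let ft := antitonic_approx prec x w zt in
  let K : {set 'I_m} := [set k : 'I_m | z 0 k < zt 0 k]%SET in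
  [/\ forall i, f 0 i <= ft 0 i,
      forall i, ((f 0 i)%:E < \big[Order.min/+oo]_(k in K) (f 0 k)%:E)%E ->
        ft 0 i = f 0 i,
      forall i, (\big[Order.max/-oo]_(k in K) (ft 0 k)%:E < (ft 0 i)%:E)%E ->
        ft 0 i = f 0 i
    & forall i j, f 0 i = f 0 j ->
        (forall k, k \in K -> prec (x i) (x k) /\ prec (x j) (x k)) ->
        ft 0 i = ft 0 j].
Proof.
move=> f ft K; split=> [i|i lt_i|i lt_i|i j eq_ij precK].
- exact: antitonic_approx_le.
- apply: antitonic_approx_eq_below => // k zk.
  by rewrite -lte_fin; apply: lt_le_trans lt_i _; apply: bigmin_le_cond; rewrite inE.
- apply: antitonic_approx_eq_above => // k zk.
  rewrite -lte_fin; apply: le_lt_trans lt_i.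
  by apply: (le_bigmax_cond _ (fun k => (ft 0 k)%:E)); rewrite inE.
(* The tie condition is symmetric in [i] and [j], so each inequality is an instance of the same
   lemma. *)
- apply/eqP; rewrite eq_le; apply/andP; split;
    apply: antitonic_approx_tie_le => // k zk;
    by have [] := precK k; rewrite ?inE.
Qed.
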